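(* Let $G$ be a 3-regular graph and let $H$ be a triangle-free 3-regular graph. Then there exists a locally bijective homomorphism from $G$ to $H$ if and only if there exists a locally bijective homomorphism from $L(G)$ to $L(H)$.
   Context: Graphs are finite and simple; $L(\cdot)$ denotes the line graph. A locally bijective homomorphism from $G$ to $H$ is a map $\psi\colon V(G)\to V(H)$ such that for every $v\in V(G)$ the restriction of $\psi$ to $N_G(v)$ is a bijection onto $N_H(\psi(v))$. *)

(* Defs.v *)
From HB Require Import structures.
From mathcomp Require Import all_boot.

Set Implicit Arguments.
Unset Strict Implicit.
Unset Printing Implicit Defensive.

(* Finite simple graphs; the vertex set is allowed to be empty. *)
Record sgraph := SGraph {
  vertex :> finType;
  adj : rel vertex;
  adj_sym : symmetric adj;
  adj_irrefl : irreflexive adj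
}.

Arguments adj {s}.

Notation "x -- y" := (adj x y) (at level 30, no associativity).

Definition neigh (G : sgraph) (v : G) : {set G} := [set u | v -- u].

Definition regular (k : nat) (G : sgraph) : Prop :=
  forall v : G, #|neigh v| = k.

Definition triangle_free (G : sgraph) : Prop :=
  forall x y z : G, ~ [/\ x -- y, y -- z & z -- x].

Definition edges (G : sgraph) : {set {set G}} :=
  [set e | [exists x : G, exists y : G, (x -- y) && (e == [set x; y])]].

Section LineGraph.
Variable G : sgraph.

Definition line_vertex : finType := {e : {set G} | e \in edges G}.

Definition line_adj : rel line_vertex :=
  fun e f => (e != f) && (val e :&: val f != set0).

Lemma line_adj_sym : symmetric line_adj.
Proof. by move=> e f; rewrite /line_adj eq_sym setIC. Qed.

Lemma line_adj_irrefl : irreflexive line_adj.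
Proof. by move=> e; rewrite /line_adj eqxx. Qed.

Definition line_graph : sgraph := SGraph line_adj_sym line_adj_irrefl.

End LineGraph.

(* The image condition alone already makes psi a graph homomorphism. *)
Definition locally_bijective_hom (G H : sgraph) (psi : G -> H) : Prop :=
  forall v : G,
    {in neigh v &, injective psi} /\ psi @: neigh v = neigh (psi v).

(* Main.v *)
Require Import Defs.
From HB Require Import structures.
From mathcomp Require Import all_boot.

Set Implicit Arguments.
Unset Strict Implicit.
Unset Printing Implicit Defensive.

(* A locally bijective homomorphism psi induces the edge map xy |-> psi(x)psi(y).
   Conversely, the three edges at a vertex v of G are mapped to three pairwise
   intersecting edges of the triangle-free graph H, which therefore share a
   vertex psi(v); counting shows that they are mapped onto the star of psi(v).
   If u, v are adjacent then psi(u) <> psi(v): otherwise the edges at u other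
   than uv would have the same images as edges at v, although all of them are
   neighbours of uv in L(G). *)

Lemma set2_injr (T : finType) (x y z : T) : [set x; y] = [set x; z] -> y = z.
Proof.
move=> eq_s; have := set22 x y; have := set22 x z.
by rewrite eq_s -{1}eq_s !inE => /orP[] /eqP zE /orP[] /eqP yE; rewrite ?yE ?zE.
Qed.

Lemma cards3_ex (T : finType) (A : {set T}) :
  #|A| = 3 ->
  exists a b c, [/\ a != b, a != c, b != c & A = [set a; b; c]].
Proof.
move=> A3; have /card_gt0P[a aA]: 0 < #|A| by rewrite A3.
have := cardsD1 a A; rewrite A3 aA => -[/esym/eqP/cards2P[b [c [bc AaE]]]].
have: a \notin [set b; c] by rewrite -AaE !inE eqxx.
rewrite !inE negb_or => /andP[ab ac].
by exists a, b, c; split; rewrite // -(setD1K aA) AaE setUA.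
Qed.

(** * Edges as two-element sets, and the star of edges at a vertex *)

Section Edges.
Variable G : sgraph.
Implicit Types (x y : G) (e f : line_graph G).

Lemma adj_neq x y : x -- y -> x != y.
Proof. by apply: contraTneq => ->; rewrite adj_irrefl. Qed.

Lemma edge_at e x : x \in val e -> exists2 y, x -- y & val e = [set x; y].
Proof.
have: val e \in edges G := valP e.
rewrite inE => /existsP[a /existsP[b /andP[ab /eqP ->]]].
rewrite !inE => /orP[] /eqP ->; first by exists b.
by exists a; rewrite 1?adj_sym // setUC.
Qed.

Lemma edge_inh e : exists x, x \in val e.
Proof.
have: val e \in edges G := valP e.
rewrite inE => /existsP[a /existsP[b /andP[ab /eqP ->]]].
by exists a; rewrite set21.
Qed.

Lemma set2_edges x y : x -- y -> [set x; y] \in edges G.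
Proof.
move=> xy; rewrite inE; apply/existsP; exists x; apply/existsP; exists y.
by rewrite xy eqxx.
Qed.

Lemma ex_edge x y : x -- y -> exists e, val e = [set x; y].
Proof.
by move=> /set2_edges xy; exists (exist (fun s => s \in edges G) _ xy).
Qed.

Lemma edgeE e x y : x != y -> x \in val e -> y \in val e -> val e = [set x; y].
Proof.
move=> xy /edge_at[z _ ->]; rewrite !inE eq_sym (negPf xy) /=.
by move=> /eqP ->.
Qed.

Lemma edge_inj e f x y :
  x != y -> x \in val e -> y \in val e -> x \in val f -> y \in val f -> e = f.
Proof.
move=> xy xe ye xf yf; apply: val_inj.
by rewrite /= (edgeE xy xe ye) (edgeE xy xf yf).
Qed.

Lemma edge_adj e x y : x != y -> x \in val e -> y \in val e -> x -- y.
Proof.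
by move=> xy /edge_at[z xz ->]; rewrite !inE eq_sym (negPf xy) => /eqP ->.
Qed.

Lemma line_adjP e f :
  reflect (e <> f /\ exists2 x, x \in val e & x \in val f) (e -- f).
Proof.
apply: (iffP andP) => [[/eqP ef /set0Pn[x]] | [ef [x xe xf]]].
  by rewrite inE => /andP[xe xf]; split=> //; exists x.
by split; [apply/eqP | apply/set0Pn; exists x; rewrite inE xe].
Qed.

Definition star x : {set line_graph G} :=
  [set e : line_graph G | x \in val e].

(** An edge at [x] is determined by its other end: both sides count the sets [[set x; y]] with [y]
    adjacent to [x]. *)
Lemma card_star x : #|star x| = #|neigh x|.
Proof.
rewrite -(card_imset _ val_inj) -(card_imset (mem (neigh x)) (@set2_injr G x)).
congr #|pred_of_set _|; apply/setP=> s; apply/imsetP/imsetP => [[e] | [y]].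
  by rewrite inE => /edge_at[y xy eE] ->; exists y; rewrite // inE.
rewrite inE => /ex_edge[e eE] ->; exists e => //.
by rewrite inE eE set21.
Qed.

End Edges.

(** If a common vertex [p] of [e] and [f] misses [g], then [p] and the points where [g] meets [e]
    and [f] are distinct and span a triangle. *)
Lemma line_triangle (H : sgraph) (e f g : line_graph H) :
  triangle_free H -> e -- f -> f -- g -> g -- e ->
  exists w, [/\ w \in val e, w \in val f & w \in val g].
Proof.
move=> tfH /line_adjP[ef [p pe pf]] /line_adjP[_ [r rf rg]].
move=> /line_adjP[_ [q qg qe]].
have [pg | pNg] := boolP (p \in val g); first by exists p.
have pq : p != q by apply: contraNneq pNg => ->.
have pr : p != r by apply: contraNneq pNg => ->.
have qr : q != r.
  by apply/eqP=> qr; apply: ef; apply: (@edge_inj _ _ _ p q) => //; rewrite qr.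
case: (tfH p q r); split; first exact: edge_adj pq pe qe.
  exact: edge_adj qr qg rg.
by rewrite adj_sym; apply: edge_adj pr pf rf.
Qed.

(** * From a map of graphs to a map of line graphs *)

Section LocallyBijective.
Variables (G H : sgraph) (psi : G -> H).
Hypothesis psi_lb : locally_bijective_hom psi.

Lemma lb_adj x y : x -- y -> psi x -- psi y.
Proof.
move=> xy; have [_ /setP/(_ (psi y))] := psi_lb x.
by rewrite [RHS]inE => <-; apply: imset_f; rewrite inE.
Qed.

Lemma lb_inj x y z : x -- y -> x -- z -> psi y = psi z -> y = z.
Proof. by move=> xy xz; have [inj _] := psi_lb x; apply: inj; rewrite inE. Qed.

Lemma lb_lift x b : psi x -- b -> exists2 y, x -- y & b = psi y.
Proof.
move=> xb; have [_ /setP/(_ b)] := psi_lb x.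
rewrite [RHS]inE xb => /imsetP[y]; rewrite inE => xy ->.
by exists y.
Qed.

Lemma edge_map_proof (e : line_graph G) : psi @: val e \in edges H.
Proof.
have [x /edge_at[y xy ->]] := edge_inh e.
by rewrite imsetU1 imset_set1 set2_edges // lb_adj.
Qed.

Definition edge_map (e : line_graph G) : line_graph H :=
  exist (fun s => s \in edges H) _ (edge_map_proof e).

Lemma edge_mapE e x y :
  val e = [set x; y] -> val (edge_map e) = [set psi x; psi y].
Proof. by move=> /= ->; rewrite imsetU1 imset_set1. Qed.

Lemma edge_map_lb : locally_bijective_hom edge_map.
Proof.
move=> e; split.
  move=> f g; rewrite !inE => /line_adjP[ef [x xe xf]] /line_adjP[eg [z ze zg]].
  move=> /(congr1 val).
  have [[y xy eE] [u xu fE]] := (edge_at xe, edge_at xf).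
  have [w zw gE] := edge_at zg.
  rewrite (edge_mapE fE) (edge_mapE gE) => eq_fg.
  apply: val_inj; rewrite /= fE gE.
  (* The edges [f] and [g] meet [e] either at the same end, where injectivity of [psi] around [x]
     suffices, or at opposite ends [x] and [y]. *)
  move: ze; rewrite eE !inE => /orP[] /eqP zE; subst z.
    by rewrite (lb_inj xu zw (set2_injr eq_fg)).
  (* Opposite ends: [psi x] lies in [[set psi y; psi w]] and differs from [psi y], so
     [psi x = psi w]. Injectivity around [y] gives [w = x], hence [g = e], a contradiction. *)
  have := set21 (psi x) (psi u); rewrite eq_fg !inE.
  rewrite (negPf (adj_neq (lb_adj xy))) /= => /eqP psi_xw.
  case: eg; apply: val_inj; rewrite /= eE gE.
  by rewrite -(lb_inj _ zw psi_xw) 1?adj_sym // setUC.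
apply/setP=> h; rewrite [RHS]inE; apply/imsetP/line_adjP.
  case=> f; rewrite inE => /line_adjP[ef [x xe xf]] ->; split; last first.
    by exists (psi x); apply: imset_f.
  have [[y xy eE] [u xu fE]] := (edge_at xe, edge_at xf).
  move=> /(congr1 val); rewrite (edge_mapE eE) (edge_mapE fE) => /set2_injr.
  by move=> /(lb_inj xy xu) yu; apply: ef; apply: val_inj; rewrite /= eE fE yu.
(* Surjectivity: [h] meets the image of [e] at some [psi x], and its other end lifts to a neighbour
   [u] of [x]; the edge [xu] is the preimage. *)
case=> eh [_ /imsetP[x xe ->]] /edge_at[_ /lb_lift[u xu ->] hE].
have [f fE] := ex_edge xu.
have fh : h = edge_map f by apply: val_inj; rewrite (edge_mapE fE).
exists f => //; rewrite inE; apply/line_adjP; split.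
  by move=> ef; apply: eh; rewrite ef.
by exists x; rewrite // fE set21.
Qed.

End LocallyBijective.

(** * From a map of line graphs back to a map of graphs *)

Section Descent.
Variables (G H : sgraph) (phi : line_graph G -> line_graph H).
Hypotheses (regG : regular 3 G) (regH : regular 3 H) (tfH : triangle_free H).
Hypothesis phi_lb : locally_bijective_hom phi.

Lemma star_adj v (e f : line_graph G) :
  e \in star v -> f \in star v -> e != f -> e -- f.
Proof.
by rewrite !inE => ve vf /eqP ef; apply/line_adjP; split=> //; exists v.
Qed.

(** Distinct edges at [v] are adjacent in the line graph, so their images are adjacent and therefore
    distinct. *)
Lemma phi_star_inj v : {in star v &, injective phi}.
Proof.
move=> e f ve vf eq_ef; apply/eqP; apply: contraTT isT => /(star_adj ve vf).
by move=> /(lb_adj phi_lb); rewrite eq_ef adj_irrefl.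
Qed.

Lemma ex_center v :
  exists w, forall e : line_graph G, v \in val e -> w \in val (phi e).
Proof.
have /cards3_ex[a [b [c [ab ac bc starE]]]]: #|star v| = 3.
  by rewrite card_star regG.
have [va vb vc]: [/\ a \in star v, b \in star v & c \in star v].
  by rewrite starE !inE !eqxx !orbT.
have phi_adj e f : e \in star v -> f \in star v -> e != f -> phi e -- phi f.
  by move=> ve vf ef; exact: (lb_adj phi_lb (star_adj ve vf ef)).
have ca : c != a by rewrite eq_sym.
have [w [wa wb wc]] := line_triangle tfH (phi_adj _ _ va vb ab)
  (phi_adj _ _ vb vc bc) (phi_adj _ _ vc va ca).
exists w => e ve; have: e \in star v by rewrite inE.
by rewrite starE !inE => /orP[/orP[]|] /eqP ->.
Qed.

Variable psi : G -> H.
Hypothesis psi_center :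
  forall v (e : line_graph G), v \in val e -> psi v \in val (phi e).

(** The choice of [psi] gives one inclusion; both sides have three elements. *)
Lemma phi_star v : phi @: star v = star (psi v).
Proof.
apply/eqP; rewrite eqEcard card_in_imset; last exact: phi_star_inj.
rewrite !card_star regG regH leqnn andbT.
apply/subsetP=> _ /imsetP[e ve ->]; move: ve; rewrite !inE.
exact: psi_center.
Qed.

Lemma center_neq u v : u -- v -> psi u != psi v.
Proof.
move=> uv; apply/eqP=> psi_uv; have [e eE] := ex_edge uv.
have [ue ve]: e \in star u /\ e \in star v by rewrite !inE eE set21 set22.
(* Take an edge [c] other than [e] at [u]. The stars of [u] and [v] have the same image, so
   [phi c = phi a] for some [a] at [v]. *)
have /card_gt0P[c]: 0 < #|star u :\ e|.
  by have := cardsD1 e (star u); rewrite card_star regG ue add1n => -[<-].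
rewrite !in_setD1 => /andP[ce uc].
have: phi c \in phi @: star v by rewrite phi_star -psi_uv -phi_star imset_f.
case/imsetP=> a va eq_ca.
have ec : e -- c by apply: (star_adj ue uc); rewrite eq_sym.
have ae : e != a.
  by apply: contraTneq (lb_adj phi_lb ec) => ->; rewrite eq_ca adj_irrefl.
(* Both [c] and [a] are neighbours of [e], so they coincide; then [c] contains [u] and [v], which
   forces [c = e]. *)
have ca := lb_inj phi_lb ec (star_adj ve va ae) eq_ca.
case/eqP: ce; apply: (@edge_inj _ _ _ u v (adj_neq uv));
  rewrite ?eE ?set21 ?set22 //.
  by move: uc; rewrite inE.
by move: va; rewrite -ca inE.
Qed.

Lemma center_lb : locally_bijective_hom psi.
Proof.
move=> v; have inj: {in neigh v &, injective psi}.
  move=> x y; rewrite !inE => vx vy eq_xy.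
  have [[e eE] [f fE]] := (ex_edge vx, ex_edge vy).
  (* Both images contain the distinct vertices [psi v] and [psi x = psi y]. *)
  have ef : phi e = phi f.
    apply: (edge_inj (center_neq vx)); [| |rewrite ?eq_xy..];
      by apply: psi_center; rewrite ?eE ?fE ?set21 ?set22.
  by apply: (@set2_injr _ v); rewrite -eE -fE (@phi_star_inj v e f) // inE
    ?eE ?fE set21.
(* Since both neighbourhoods have three elements, it is enough that [psi] preserves adjacency. *)
split=> //; apply/eqP; rewrite eqEcard card_in_imset // regG regH leqnn andbT.
apply/subsetP=> _ /imsetP[x xN ->]; move: xN; rewrite !inE => vx.
have [e eE] := ex_edge vx.
have [ve xe] : v \in val e /\ x \in val e by rewrite eE set21 set22.
exact: (edge_adj (center_neq vx) (psi_center ve) (psi_center xe)).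
Qed.

End Descent.

Theorem theorem2 (G H : sgraph) (regG : regular 3 G) (regH : regular 3 H)
    (tfH : triangle_free H) :
  (exists psi : G -> H, locally_bijective_hom psi) <->
  (exists phi : line_graph G -> line_graph H, locally_bijective_hom phi).
Proof.
split=> [[psi psi_lb] | [phi phi_lb]].
  by exists (edge_map psi_lb); apply: edge_map_lb.
(* Choose for every vertex [v] a common vertex of the images of the edges at [v]. *)
have [psi psi_center] := fin_all_exists (ex_center regG tfH phi_lb).
by exists psi; apply: center_lb phi_lb _ psi_center.
Qed.
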